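(* Let $G=(V,E)$ be a directed acyclic graph, let $S\in PD(\mathbb R^{|V|})$ and let $T\in \mathrm{Sym}^3(\mathbb R^{|V|})$. Then $(S,T)$ lies in the model $\mathcal M^{\leq 3}(G)$ if and only if for every vertex $v\in V$ the matrix $$M_v := \begin{bmatrix} S_{\mathrm{pa}(v),\mathrm{nd}(v)} & T_{\mathrm{pa}(v),\,\mathrm{nd}(v)\times V}\\ S_{v,\mathrm{nd}(v)} & T_{v,\,\mathrm{nd}(v)\times V}\end{bmatrix}$$ has rank equal to $|\mathrm{pa}(v)|$.
   Context: $V$ is a finite set. For a directed acyclic graph (DAG) $G=(V,E)$, write $j\to i$ for $(j,i)\in E$. The set of parents of $i$ is $\mathrm{pa}(i)=\{j\in V: (j,i)\in E\}$. The set of non-descendants of $i$, $\mathrm{nd}(i)$, is the set of $j\in V$ such that there is no directed path from $i$ to $j$; the trivial path of length $0$ counts, so $i\notin \mathrm{nd}(i)$. $PD(\mathbb R^{|V|})$ is the set of real symmetric positive definite $|V|\times|V|$ matrices $S=(s_{ij})_{i,j\in V}$. $\mathrm{Sym}^3(\mathbb R^{|V|})$ is the space of real symmetric tensors $T=(t_{ijk})_{i,j,k\in V}$, i.e. tensors invariant under permutations of the three indices. A tensor in $\mathrm{Sym}^3(\mathbb R^{|V|})$ is diagonal if its $(i,j,k)$ entry is $0$ unless $i=j=k$. $\mathbb R^E$ is the set of real $|V|\times|V|$ matrices $\Lambda=(\lambda_{ji})$ with $\lambda_{ji}=0$ whenever $(j,i)\notin E$; for such $\Lambda$ the matrix $I-\Lambda$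 is invertible because $G$ is acyclic. $\bullet$ is the Tucker product: for a tensor $W$ and a matrix $B$, both indexed by $V$, $(W\bullet B\bullet B\bullet B)_{ijk}=\sum_{a,b,c\in V} W_{abc}B_{ai}B_{bj}B_{ck}$. The second- and third-order moment model of $G$ is the set $\mathcal M^{\leq 3}(G)\subseteq PD(\mathbb R^{|V|})\times \mathrm{Sym}^3(\mathbb R^{|V|})$ of all pairs $(S,T)$ of the form $$S=(I-\Lambda)^{-T}\Omega^{(2)}(I-\Lambda)^{-1},\qquad T=\Omega^{(3)}\bullet(I-\Lambda)^{-1}\bullet(I-\Lambda)^{-1}\bullet(I-\Lambda)^{-1},$$ with $\Omega^{(2)}\in PD(\mathbb R^{|V|})$ diagonal, $\Omega^{(3)}\in \mathrm{Sym}^3(\mathbb R^{|V|})$ diagonal and $\Lambda\in\mathbb R^E$. For $A,B,C\subseteq V$: $S_{A,B}$ is the matrix with entries $s_{ab}$, rows indexed by $a\in A$, columns by $b\in B$; $T_{A,B\times C}$ is the matrix with entries $t_{abc}$, rows indexed by $a\in A$ and columns by pairs $(b,c)\in B\times C$. A single vertex $v$ used as an index set means $\{v\}$. A matrix with no columns has rank $0$. *)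

(* Defs.v *)
From mathcomp Require Import all_boot all_order all_algebra reals.

Set Implicit Arguments.
Unset Strict Implicit.
Unset Printing Implicit Defensive.

Import GRing.Theory Num.Theory.
Local Open Scope ring_scope.

(** A directed graph on the finite type [V] is a relation [e], [e j i] standing
    for the edge [j -> i].  Closed walks rather than simple cycles are excluded,
    so that loops are ruled out as well. *)
Definition dag (V : finType) (e : rel V) : Prop :=
  forall c : seq V, cycle e c -> c = [::].

Definition pa (V : finType) (e : rel V) (v : V) : {set V} := [set j | e j v].

(** [connect e] is reflexive, hence [v \notin nd e v]. *)
Definition nd (V : finType) (e : rel V) (v : V) : {set V} :=
  [set j | ~~ connect e v j].

(** [V] x [V] matrices are represented in ['M_#|V|] through the bijection
    [enum_rank : V -> 'I_#|V|]; [ent A i j] is the entry at the vertices i, j. *)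
Definition ent (R : realType) (V : finType) (A : 'M[R]_#|V|) (i j : V) : R :=
  A (enum_rank i) (enum_rank j).

Definition posdefmx (R : realType) (n : nat) (A : 'M[R]_n) : Prop :=
  A^T = A /\ forall x : 'cV[R]_n, x != 0 -> 0 < (x^T *m A *m x) 0 0.

Definition edge_supported (R : realType) (V : finType) (e : rel V)
    (L : 'M[R]_#|V|) : Prop :=
  forall j i : V, ~~ e j i -> ent L j i = 0.

Definition tensor3 (R : realType) (V : finType) : Type := V -> V -> V -> R.

Definition sym3 (R : realType) (V : finType) (T : tensor3 R V) : Prop :=
  forall i j k : V,
    [/\ T i k j = T i j k, T j i k = T i j k, T j k i = T i j k,
        T k i j = T i j k & T k j i = T i j k].

Definition diag3 (R : realType) (V : finType) (T : tensor3 R V) : Prop :=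
  forall i j k : V, ~~ ((i == j) && (j == k)) -> T i j k = 0.

Definition tucker3 (R : realType) (V : finType) (W : tensor3 R V)
    (B1 B2 B3 : 'M[R]_#|V|) : tensor3 R V :=
  fun i j k =>
    \sum_(a : V) \sum_(b : V) \sum_(c : V)
      W a b c * ent B1 a i * ent B2 b j * ent B3 c k.

(** When [e] is acyclic and [L] is supported on its edges, [1%:M - L] is
    invertible, so [invmx] is the genuine inverse. *)
Definition moment_model (R : realType) (V : finType) (e : rel V)
    (S : 'M[R]_#|V|) (T : tensor3 R V) : Prop :=
  exists (O2 : 'M[R]_#|V|) (O3 : tensor3 R V) (L : 'M[R]_#|V|),
    let B := invmx (1%:M - L) in
    [/\ posdefmx O2 /\ is_diag_mx O2,
        sym3 O3 /\ diag3 O3,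
        edge_supported e L,
        S = B^T *m O2 *m B
      & forall i j k : V, T i j k = tucker3 O3 B B B i j k].

Definition mxblk (R : realType) (V : finType) (S : 'M[R]_#|V|)
    (A B : {set V}) : 'M[R]_(#|A|, #|B|) :=
  \matrix_(a < #|A|, b < #|B|) ent S (enum_val a) (enum_val b).

Definition tensorblk (R : realType) (V : finType) (T : tensor3 R V)
    (A B C : {set V}) : 'M[R]_(#|A|, #|setX B C|) :=
  \matrix_(a < #|A|, p < #|setX B C|)
    T (enum_val a) (enum_val p).1 (enum_val p).2.

Definition Mmx (R : realType) (V : finType) (e : rel V)
    (S : 'M[R]_#|V|) (T : tensor3 R V) (v : V) :
    'M[R]_(#|pa e v| + #|[set v]|, #|nd e v| + #|setX (nd e v) [set: V]|) :=
  block_mx (mxblk S (pa e v) (nd e v)) (tensorblk T (pa e v) (nd e v) [set: V])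
           (mxblk S [set v] (nd e v))  (tensorblk T [set v] (nd e v) [set: V]).

(* Main.v *)
Require Import Defs.
From mathcomp Require Import all_boot all_order all_algebra reals.
From mathcomp Require Import boolp.
From mathcomp Require Import ring.

(** Formally, the model says that a vector with moments [(S, T)] solves the
    structural equations [X_v = sum_(p -> v) L_pv X_p + eps_v] with noise whose
    second and third moments are diagonal.  Write [D = 1 - L].  Everything rests
    on one equivalent condition, called [regression] below: at every vertex [v],
    the column of [L] at [v] is supported on the parents of [v], and contracting
    one index of [S] and of [T] with the column of [D] at [v] (passing from
    [X_v] to the residual [eps_v]) gives zero as soon as another index is a
    non-descendant of [v].

    Model to regression ([regression_of_moment_model]).  Contracting one index
    of [T = O3 . B . B . B], where [B = D^-1], with [D] leaves
    [O3 . 1 . B . B], whose entry at [v, j, k] is [O3_vvv B_vj B_vk].  Since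
    [B_vj] sums the weights of the directed paths from [v] to [j], it vanishes
    for [j] in [nd v] ([path_matrix_nd]); likewise for [S].

    Regression to model ([moment_model_of_regression]).  The noise moments are
    forced to be [D^T S D] and [T . D . D . D]; they are to be shown diagonal.
    Take [u != v].  By acyclicity one of the two, say [u], is a non-descendant
    of the other, and then so are all the parents of [u].  The column of [D]
    at [u] lives on [u] and its parents, where the contraction with the column
    at [v] vanishes ([residual_orthogonal]).

    Regression and rank ([rank_Mmx]).  The upper block row of [M_v] contains the
    principal submatrix of [S] on [pa v], because [pa v] is contained in [nd v];
    it is positive definite, so the upper rows are independent.  Hence
    [M_v] has rank [#|pa v|] exactly when its last row is a combination of the
    upper ones, and the coefficients are the column of [L] at [v]. *)

Set Implicit Arguments.
Unset Strict Implicit.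
Unset Printing Implicit Defensive.

Import Order.TTheory GRing.Theory Num.Theory.
Local Open Scope ring_scope.

(** * Directed acyclic graphs *)

Section Dag.
Variables (V : finType) (e : rel V).
Hypothesis he : dag e.

Lemma dag_edge_nconnect j i : e j i -> ~~ connect e i j.
Proof.
move=> eji; apply/negP => /connectP[p ep Ej].
by have := he (c := i :: p); rewrite /= rcons_path ep -Ej eji => /(_ isT).
Qed.

Lemma dag_connect_antisym u v : u != v -> connect e u v -> ~~ connect e v u.
Proof.
move=> neq_uv /connectP[[|x p] /= ep Ev]; first by rewrite Ev eqxx in neq_uv.
have /andP[eux exp] := ep; apply/negP => cvu.
have /negP[] := dag_edge_nconnect eux; apply: connect_trans cvu.
by apply/connectP; exists p.
Qed.

Lemma dag_nd_total u v : u != v -> (u \in nd e v) || (v \in nd e u).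
Proof.
move=> neq_uv; rewrite !inE; case: (boolP (connect e u v)) => //=.
  by move=> cuv; rewrite (dag_connect_antisym neq_uv cuv).
by rewrite orbT.
Qed.

Lemma pa_nd p v : p \in pa e v -> p \in nd e v.
Proof. by rewrite !inE => /dag_edge_nconnect. Qed.

(** A path from [v] to a parent of [u] extends to [u]. *)
Lemma nd_parent b u v : e b u -> u \in nd e v -> b \in nd e v.
Proof.
rewrite !inE => ebu; apply: contra => cvb.
exact: connect_trans cvb (connect1 ebu).
Qed.

(** Induction from the sinks upwards: the set of descendants strictly shrinks
    along an edge. *)
Lemma dag_ind (P : V -> Prop) :
  (forall v, (forall i, e v i -> P i) -> P v) -> forall v, P v.
Proof.
move=> IH v; have [n] := ubnP #|connect e v|.
elim: n v => // n IHn v le_vn; apply: IH => i evi; apply: IHn.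
rewrite -ltnS; apply: leq_trans le_vn; rewrite ltnS; apply: proper_card.
apply/properP; split.
  by apply/subsetP => j; apply: connect_trans (connect1 evi).
by exists v; [exact: connect0 | exact: dag_edge_nconnect].
Qed.

End Dag.

(** * Matrices indexed by vertices *)

Section Entries.
Variables (R : realType) (V : finType).
Implicit Types (A B : 'M[R]_#|V|) (f : V -> R).

Lemma big_enum_rank (F : 'I_#|V| -> R) : \sum_k F k = \sum_x F (enum_rank x).
Proof. by rewrite (reindex _ (onW_bij _ (@enum_rank_bij V))). Qed.

Lemma ent_mul A B i j : ent (A *m B) i j = \sum_k ent A i k * ent B k j.
Proof. by rewrite /ent mxE big_enum_rank. Qed.

Lemma ent_tr A i j : ent A^T i j = ent A j i.
Proof. by rewrite /ent mxE. Qed.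

Lemma ent1 i j : ent (1%:M : 'M[R]_#|V|) i j = (i == j)%:R.
Proof. by rewrite /ent mxE (inj_eq enum_rank_inj). Qed.

Lemma ent1B A i j : ent (1%:M - A) i j = (i == j)%:R - ent A i j.
Proof. by rewrite -ent1 /ent !mxE. Qed.

Lemma sum_deltar f i : \sum_k f k * (k == i)%:R = f i.
Proof.
rewrite (bigD1 i) //= eqxx mulr1 big1 ?addr0 // => k /negPf->.
by rewrite mulr0.
Qed.

Lemma sum_deltal f i : \sum_k (i == k)%:R * f k = f i.
Proof.
by rewrite -[RHS]sum_deltar; apply: eq_bigr => k _; rewrite mulrC eq_sym.
Qed.

Lemma is_diag_ent A : (forall i j, i != j -> ent A i j = 0) -> is_diag_mx A.
Proof.
move=> A0; apply/is_diag_mxP => i j neq_ij.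
have := A0 (enum_val i) (enum_val j); rewrite /ent !enum_valK; apply.
by rewrite (inj_eq enum_val_inj).
Qed.

Lemma ent_is_diag A i j : is_diag_mx A -> i != j -> ent A i j = 0.
Proof.
move=> /is_diag_mxP A0 neq_ij; apply: A0.
by rewrite val_eqE (inj_eq enum_rank_inj).
Qed.

Lemma posdef_sym A i j : posdefmx A -> ent A i j = ent A j i.
Proof. by case=> sA _; rewrite -{1}sA ent_tr. Qed.

(** The terms of the quadratic form are assumed to vanish one by one, because a
    vector [y] supported on a set of vertices and orthogonal to the columns of
    [A] in that set yields exactly this. *)
Lemma posdef_form_eq0 A (y : V -> R) : posdefmx A ->
  (forall j, (\sum_i y i * ent A i j) * y j = 0) -> forall i, y i = 0.
Proof.
move=> [_ posA] y0 i; pose x : 'cV[R]_#|V| := \col_k y (enum_val k).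
have [x0|/posA] := eqVneq x 0.
  by have := congr1 (fun z : 'cV_#|V| => z (enum_rank i) 0) x0;
     rewrite !mxE enum_rankK.
rewrite mxE big_enum_rank big1 ?ltxx // => j _.
rewrite !mxE big_enum_rank enum_rankK -[RHS](y0 j); congr (_ * _).
by apply: eq_bigr => k _; rewrite !mxE enum_rankK.
Qed.

Lemma posdef_congr n (A D : 'M[R]_n) :
  D \in unitmx -> posdefmx A -> posdefmx (D^T *m A *m D).
Proof.
move=> uD [sA posA]; split; first by rewrite !trmx_mul trmxK sA mulmxA.
move=> x x0; have : D *m x != 0.
  by apply: contraNneq x0 => Dx0; rewrite -(mulKmx uD x) Dx0 mulmx0.
by move=> /posA; rewrite trmx_mul !mulmxA.
Qed.

(** * Contracting a tensor one index at a time *)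

Definition contract1 B (T : tensor3 R V) : tensor3 R V :=
  fun i j k => \sum_a T a j k * ent B a i.
Definition contract2 B (T : tensor3 R V) : tensor3 R V :=
  fun i j k => \sum_b T i b k * ent B b j.
Definition contract3 B (T : tensor3 R V) : tensor3 R V :=
  fun i j k => \sum_c T i j c * ent B c k.

Lemma contract12 A B T :
  contract1 A (contract2 B T) = contract2 B (contract1 A T).
Proof.
apply/funext => i; apply/funext => j; apply/funext => k.
rewrite /contract1 /contract2; under eq_bigr => a _ do rewrite mulr_suml.
rewrite exchange_big /=; apply: eq_bigr => b _; rewrite mulr_suml.
by apply: eq_bigr => a _; ring.
Qed.

Lemma contract13 A B T :
  contract1 A (contract3 B T) = contract3 B (contract1 A T).
Proof.
apply/funext => i; apply/funext => j; apply/funext => k.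
rewrite /contract1 /contract3; under eq_bigr => a _ do rewrite mulr_suml.
rewrite exchange_big /=; apply: eq_bigr => b _; rewrite mulr_suml.
by apply: eq_bigr => a _; ring.
Qed.

Lemma contract23 A B T :
  contract2 A (contract3 B T) = contract3 B (contract2 A T).
Proof.
apply/funext => i; apply/funext => j; apply/funext => k.
rewrite /contract2 /contract3; under eq_bigr => a _ do rewrite mulr_suml.
rewrite exchange_big /=; apply: eq_bigr => b _; rewrite mulr_suml.
by apply: eq_bigr => a _; ring.
Qed.

Lemma contract_comp A B f i :
  \sum_b (\sum_a f a * ent A a b) * ent B b i = \sum_a f a * ent (A *m B) a i.
Proof.
under eq_bigr => b _ do rewrite mulr_suml.
rewrite exchange_big /=; apply: eq_bigr => a _.
by rewrite ent_mul mulr_sumr; apply: eq_bigr => b _; rewrite mulrA.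
Qed.

Lemma contract_inv A B f i : A *m B = 1%:M ->
  \sum_b (\sum_a f a * ent A a b) * ent B b i = f i.
Proof.
rewrite contract_comp => ->; under eq_bigr do rewrite ent1.
exact: sum_deltar.
Qed.

Lemma contract1K A B T : A *m B = 1%:M -> contract1 B (contract1 A T) = T.
Proof.
move=> AB1; apply/funext => i; apply/funext => j; apply/funext => k.
exact: (contract_inv (fun a => T a j k)).
Qed.

Lemma contract2K A B T : A *m B = 1%:M -> contract2 B (contract2 A T) = T.
Proof.
move=> AB1; apply/funext => i; apply/funext => j; apply/funext => k.
exact: (contract_inv (fun b => T i b k)).
Qed.

Lemma contract3K A B T : A *m B = 1%:M -> contract3 B (contract3 A T) = T.
Proof.
move=> AB1; apply/funext => i; apply/funext => j; apply/funext => k.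
exact: (contract_inv (fun c => T i j c)).
Qed.

Lemma tucker3E W B1 B2 B3 :
  tucker3 W B1 B2 B3 = contract1 B1 (contract2 B2 (contract3 B3 W)).
Proof.
apply/funext => i; apply/funext => j; apply/funext => k.
apply: eq_bigr => a _; rewrite /contract2 /contract3 mulr_suml.
apply: eq_bigr => b _; rewrite !mulr_suml.
by apply: eq_bigr => c _; ring.
Qed.

Lemma tucker3K A B T : A *m B = 1%:M ->
  tucker3 (tucker3 T A A A) B B B = T.
Proof.
move=> AB1; rewrite !tucker3E -!contract13 -!contract12 -contract23.
by rewrite (contract1K _ AB1) (contract2K _ AB1) (contract3K _ AB1).
Qed.

(** The two adjacent transpositions generate all permutations of the indices. *)
Lemma sym3_swaps (T : tensor3 R V) : (forall i j k, T j i k = T i j k) ->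
  (forall i j k, T i k j = T i j k) -> sym3 T.
Proof.
move=> T12 T23 i j k.
by split; [rewrite T23 | rewrite T12 | rewrite T23 T12 | rewrite T12 T23 |
           rewrite T12 T23 T12].
Qed.

Lemma tucker3_sym T B : sym3 T -> sym3 (tucker3 T B B B).
Proof.
move=> sT; apply: sym3_swaps => i j k; rewrite /tucker3.
  rewrite exchange_big /=; apply: eq_bigr => a _; apply: eq_bigr => b _.
  by apply: eq_bigr => c _; have [_ -> _ _ _] := sT a b c; ring.
apply: eq_bigr => a _; rewrite exchange_big /=; apply: eq_bigr => b _.
by apply: eq_bigr => c _; have [-> _ _ _ _] := sT a b c; ring.
Qed.

End Entries.

(** * Structural equations on a DAG *)

(** Regressing [v] on its parents, with coefficients [l], leaves a residual
    whose second and third moments with a non-descendant of [v] vanish. *)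
Definition regression (R : realType) (V : finType) (e : rel V)
    (S : 'M[R]_#|V|) (T : tensor3 R V) (v : V) (l : V -> R) : Prop :=
  [/\ forall p, ~~ e p v -> l p = 0,
      forall j, j \in nd e v -> ent S v j = \sum_p l p * ent S p j
    & forall j k, j \in nd e v -> T v j k = \sum_p l p * T p j k].

Section Structural.
Variables (R : realType) (V : finType) (e : rel V).
Hypothesis he : dag e.
Variable L : 'M[R]_#|V|.
Hypothesis hL : edge_supported e L.
Let D : 'M[R]_#|V| := 1%:M - L.
Let B : 'M[R]_#|V| := invmx D.

(** A column [x] with [x = L x] vanishes at every vertex, by induction from the
    sinks: its value at [v] only involves its values at the children of [v]. *)
Lemma structural_unit : D \in unitmx.
Proof.
rewrite -unitmx_tr -row_free_unit; apply/inj_row_free => x xD0.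
suff x0 v : x 0 (enum_rank v) = 0.
  by apply/rowP => k; rewrite mxE -(enum_valK k) x0.
elim/(dag_ind he): v => v IH.
have := congr1 (fun z : 'rV_#|V| => z 0 (enum_rank v)) xD0.
rewrite mxE [X in _ = X]mxE big_enum_rank.
under eq_bigr => a _.
  have -> : D^T (enum_rank a) (enum_rank v) = (v == a)%:R - ent L v a.
    by rewrite mxE -/(ent D v a) ent1B.
  have -> : x 0 (enum_rank a) * ((v == a)%:R - ent L v a)
     = (v == a)%:R * x 0 (enum_rank a).
    have [/IH->|/hL->] := boolP (e v a); first by rewrite mul0r mulr0.
    by rewrite subr0 mulrC.
  over.
by rewrite sum_deltal.
Qed.

(** From [B = 1 + L B]: the entry at [v, j] is a combination of the entries at
    [i, j], for [i] a child of [v], of which [j] is a non-descendant as well. *)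
Lemma path_matrix_nd v j : j \in nd e v -> ent B v j = 0.
Proof.
have DB : D *m B = 1%:M by rewrite mulmxV // structural_unit.
elim/(dag_ind he): v => v IH vj.
have nvj : v != j by apply: contraTneq vj => ->; rewrite inE connect0.
have : ent (D *m B) v j = 0 by rewrite DB ent1 (negPf nvj).
rewrite ent_mul; under eq_bigr => a _.
  have -> : ent D v a * ent B a j = (v == a)%:R * ent B a j.
    rewrite ent1B; have [eva|/hL->] := boolP (e v a); last by rewrite subr0.
    rewrite IH ?mulr0 //; move: vj; rewrite !inE; apply: contra.
    exact: connect_trans (connect1 eva).
  over.
by rewrite sum_deltal.
Qed.

(** Column [v] of [D] turns [X_v] into its residual. *)
Lemma sum_structural (f : V -> R) v :
  \sum_a f a * ent D a v = f v - \sum_p ent L p v * f p.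
Proof.
rewrite -[f v](sum_deltar _ v) -sumrB; apply: eq_bigr => a _.
by rewrite ent1B; ring.
Qed.

(** If [f] vanishes at the non-descendants of [v], so does its contraction with
    [D], since column [u] of [D] lives on [u] and the parents of [u]. *)
Lemma residual_orthogonal (f : V -> R) u v :
  (forall j, j \in nd e v -> f j = 0) -> u \in nd e v ->
  \sum_b f b * ent D b u = 0.
Proof.
move=> f0 uv; apply: big1 => b _; rewrite ent1B.
have [->|nbu] := eqVneq b u; first by rewrite f0 ?mul0r.
have [ebu|/hL->] := boolP (e b u); last by rewrite subr0 mulr0.
by rewrite f0 ?mul0r // (nd_parent ebu uv).
Qed.

(** Contracting a single index of [S] and [T] with [D] cancels one factor [B];
    diagonal noise then pins the other indices of the noise to [v], leaving a
    factor [B_vj]. *)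
Lemma regression_of_moment_model O2 W S T :
  is_diag_mx O2 -> diag3 W -> S = B^T *m O2 *m B ->
  (forall i j k, T i j k = tucker3 W B B B i j k) ->
  forall v, regression e S T v (fun p => ent L p v).
Proof.
move=> dO dW SE TE v.
have BD : B *m D = 1%:M by rewrite mulVmx ?structural_unit.
split=> [p /hL // | j vj | j k vj].
  have : \sum_a ent S^T j a * ent D a v = 0.
    rewrite -ent_mul SE !trmx_mul trmxK -!mulmxA BD mulmx1 ent_mul.
    apply: big1 => a _; rewrite !ent_tr; have [->|nav] := eqVneq a v.
      by rewrite path_matrix_nd ?mul0r.
    by rewrite [ent O2 v a](ent_is_diag dO) ?mulr0 // eq_sym.
  rewrite sum_structural ent_tr => /eqP; rewrite subr_eq0 => /eqP->.
  by apply: eq_bigr => p _; rewrite ent_tr.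
have : contract1 D T v j k = 0.
  have -> : T = tucker3 W B B B.
    by apply/funext => x; apply/funext => y; apply/funext => z; apply: TE.
  rewrite tucker3E (contract1K _ BD); apply: big1 => b _; rewrite /contract3.
  have [->|nbv] := eqVneq b v; first by rewrite path_matrix_nd ?mulr0.
  rewrite big1 ?mul0r // => c _.
  by rewrite dW ?mul0r // eq_sym (negPf nbv).
rewrite /contract1 sum_structural => /eqP.
by rewrite subr_eq0 => /eqP->.
Qed.

(** Inverting the structural equations leaves no choice for the noise moments;
    the regression condition makes them diagonal. *)
Lemma moment_model_of_regression S T : posdefmx S -> sym3 T ->
  (forall v, regression e S T v (fun p => ent L p v)) -> moment_model e S T.
Proof.
move=> pS sT reg; have uD := structural_unit.
have DB : D *m B = 1%:M by rewrite mulmxV.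
pose O2 := D^T *m S *m D; pose O3 := tucker3 T D D D.
have pO2 : posdefmx O2 by apply: posdef_congr.
have sO3 : sym3 O3 by apply: tucker3_sym.
have O2_nd u v : u \in nd e v -> ent O2 v u = 0.
  rewrite ent_mul; apply: residual_orthogonal => j vj.
  have [_ regS _] := reg v; rewrite ent_mul.
  under eq_bigr => a _ do rewrite ent_tr mulrC.
  by rewrite (sum_structural (fun a => ent S a j)) regS ?subrr.
have O3_nd u v w : u \in nd e v -> O3 v u w = 0.
  (* The first index is contracted innermost, so that [regression] at [v]
     applies before the sum over the second index. *)
  move=> vu; rewrite /O3 tucker3E contract12 contract13.
  apply: residual_orthogonal vu => j vj; apply: big1 => c _.
  have [_ _ regT] := reg v.
  by rewrite /contract1 (sum_structural (fun a => T a j c)) regT ?subrr ?mul0r.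
have O3_neq u v w : u != v -> O3 u v w = 0.
  move=> /(dag_nd_total he)/orP[vu|uv]; last exact: O3_nd.
  by have [_ <- _ _ _] := sO3 u v w; apply: O3_nd.
exists O2, O3, L; split=> //.
- split=> //; apply: is_diag_ent => u v /(dag_nd_total he)/orP[vu|uv].
    by rewrite (posdef_sym _ _ pO2) O2_nd.
  exact: O2_nd.
- split=> // i j k; rewrite negb_and => /orP[/O3_neq-> //|/O3_neq jk].
  by have [_ _ <- _ _] := sO3 i j k.
- rewrite -/D -/B /O2 !mulmxA -trmx_mul DB trmx1 mul1mx -mulmxA DB.
  by rewrite mulmx1.
- by move=> i j k; rewrite -/D -/B tucker3K.
Qed.

End Structural.

(** * The rank condition *)

(** Extension by zero of a family indexed by [A] to all of [V], written as a sum
    so that no default index is required. *)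
Definition extend0 (R : realType) (V : finType) (A : {set V})
    (x : 'I_#|A| -> R) (p : V) : R := \sum_(a | enum_val a == p) x a.

Section Rank.
Variables (R : realType) (V : finType).

Lemma sum_extend0 (A : {set V}) (x : 'I_#|A| -> R) (F : V -> R) :
  \sum_p extend0 x p * F p = \sum_a x a * F (enum_val a).
Proof.
rewrite [RHS](partition_big (fun a => enum_val a) predT) //=.
apply: eq_bigr => p _; rewrite mulr_suml.
by apply: eq_bigr => a /eqP->.
Qed.

Lemma extend0_val (A : {set V}) (x : 'I_#|A| -> R) a :
  extend0 x (enum_val a) = x a.
Proof.
by rewrite /extend0 (big_pred1 a) // => b; rewrite (inj_eq enum_val_inj).
Qed.

Lemma extend0_out (A : {set V}) (x : 'I_#|A| -> R) p :
  p \notin A -> extend0 x p = 0.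
Proof.
move=> pA; rewrite /extend0 big_pred0 // => a.
by apply: contraNF pA => /eqP<-; apply: enum_valP.
Qed.

Lemma rank_col_mx_free m n p (A : 'M[R]_(m, n)) (b : 'M[R]_(p, n)) :
  row_free A -> \rank (col_mx A b) = m <-> (b <= A)%MS.
Proof.
move=> fA; have rA : \rank A = m by apply/eqP.
have sA : (A <= col_mx A b)%MS by rewrite -addsmxE addsmxSl.
have [_ Er] := mxrank_leqif_sup sA.
have -> : (b <= A)%MS = (col_mx A b <= A)%MS.
  by rewrite -addsmxE addsmx_sub submx_refl.
by rewrite -Er rA; split=> [->|/eqP].
Qed.

Variables (e : rel V) (S : 'M[R]_#|V|) (T : tensor3 R V).
Hypotheses (he : dag e) (pS : posdefmx S).

(** A vanishing combination of the upper rows of [M_v], restricted to the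
    columns of [S] indexed by [pa v], makes the quadratic form of [S] vanish. *)
Lemma upper_row_free v :
  row_free (row_mx (mxblk S (pa e v) (nd e v))
                   (tensorblk T (pa e v) (nd e v) [set: V])).
Proof.
apply/inj_row_free => x; rewrite mul_mx_row => /(congr1 lsubmx).
rewrite row_mxKl linear0 => xS0; apply/rowP => a; rewrite mxE.
rewrite -(extend0_val (x 0)); apply: (posdef_form_eq0 pS) => j.
have [jv|/(extend0_out (x 0))->] := boolP (j \in pa e v); last by rewrite mulr0.
have jn := pa_nd he jv; rewrite sum_extend0.
have := congr1 (fun z : 'rV_#|nd e v| => z 0 (enum_rank_in jn j)) xS0.
rewrite !mxE; under eq_bigr => b _ do rewrite mxE enum_rankK_in //.
by move=> ->; rewrite mul0r.
Qed.

(** The upper rows being independent, the rank condition says that the last row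
    is a combination of them; its coefficients, extended by zero outside the
    parents, are the regression coefficients. *)
Lemma rank_Mmx v :
  \rank (Mmx e S T v) = #|pa e v| <-> exists l, regression e S T v l.
Proof.
rewrite /Mmx /block_mx (rank_col_mx_free _ (upper_row_free v)); split.
  case/submxP => C /eqP; rewrite mul_mx_row => /eqP/eq_row_mx[ES ET].
  pose i0 : 'I_#|[set v]| := cast_ord (esym (cards1 v)) ord0.
  have Ev : enum_val i0 = v by apply/set1P/enum_valP.
  exists (extend0 (C i0)); split=> [p npv | j vj | j k vj].
  - by apply: extend0_out; rewrite inE.
  - have := congr1 (fun z : 'M_(_, #|nd e v|) => z i0 (enum_rank_in vj j)) ES.
    rewrite !mxE Ev enum_rankK_in // => ->; rewrite sum_extend0.
    by apply: eq_bigr => a _; rewrite mxE enum_rankK_in.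
  - have vjk : (j, k) \in setX (nd e v) [set: V] by rewrite in_setX vj inE.
    have := congr1 (fun z : 'M_(_, #|setX (nd e v) [set: V]|) =>
      z i0 (enum_rank_in vjk (j, k))) ET.
    rewrite !mxE Ev enum_rankK_in // => ->.
    rewrite (sum_extend0 _ (fun p => T p j k)).
    by apply: eq_bigr => a _; rewrite mxE enum_rankK_in.
case=> l [l0 regS regT]; apply/submxP.
exists (\matrix_(i, a) l (enum_val a)); rewrite mul_mx_row.
have sumE F : \sum_p l p * F p =
    \sum_(a < #|pa e v|) l (enum_val a) * F (enum_val a).
  rewrite -(big_enum_val (fun p => l p * F p)) /= [RHS]big_mkcond.
  apply: eq_bigr => p _; rewrite inE; case: ifP => // /negbT/l0->.
  by rewrite mul0r.
congr row_mx; apply/matrixP => i b; rewrite !mxE;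
  rewrite (set1P (enum_valP i)).
  rewrite regS ?enum_valP // sumE.
  by apply: eq_bigr => a _; rewrite !mxE.
have := enum_valP b; rewrite inE => /andP[vb _].
rewrite regT // (sumE (fun p => T p _ _)).
by apply: eq_bigr => a _; rewrite !mxE.
Qed.

End Rank.

Theorem theorem3p1 (R : realType) (V : finType) (e : rel V)
    (S : 'M[R]_#|V|) (T : tensor3 R V)
    (he : dag e) (hS : posdefmx S) (hT : sym3 T) :
  moment_model e S T <-> (forall v : V, \rank (Mmx e S T v) = #|pa e v|).
Proof.
split=> [[O2 [W [L [[_ dO] [_ dW] hL SE TE]]]] v | rk].
  apply/(rank_Mmx T he hS).
  exists (fun p => ent L p v).
  exact: (regression_of_moment_model he hL dO dW).
have /choice[l reg] v : exists l, regression e S T v l.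
  exact/(rank_Mmx T he hS).
pose L : 'M[R]_#|V| := \matrix_(p, v) l (enum_val v) (enum_val p).
have LE p v : ent L p v = l v p by rewrite /ent mxE !enum_rankK.
apply: (@moment_model_of_regression R V e he L) => // [p v npv | v].
  by rewrite LE; have [-> //] := reg v.
by have -> : (fun p => ent L p v) = l v by apply/funext => p.
Qed.
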